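(* Let $k\ge 2$ and $1\le r\le k-1$. The generating function $\sum_\pi x^{|\pi|}$, where the sum is over all $123$-avoiding permutations $\pi$ with exactly $r$ occurrences of the pattern $(k-1)(k-2)\dots1k$, is given by $$x^{(r-1)/2}\frac{\left(U_{k-1}\left(\frac1{2\sqrt x}\right)\right)^{r-1}}{\left(U_k\left(\frac1{2\sqrt x}\right)\right)^{r+1}}.$$
   Context: For a permutation $\pi=\pi_1\cdots\pi_n$ of $\{1,\dots,n\}$ and a permutation $\sigma=\sigma_1\cdots\sigma_m$ of $\{1,\dots,m\}$, an occurrence of the pattern $\sigma$ in $\pi$ is a choice of indices $i_1<\dots<i_m$ such that $\pi_{i_1}\cdots\pi_{i_m}$ is in the same relative order as $\sigma$; $\pi$ is $\sigma$-avoiding if there is no occurrence. The pattern $(k-1)(k-2)\dots1k$ is the permutation of $\{1,\dots,k\}$ whose first $k-1$ entries are $k-1,\dots,1$ and whose last entry is $k$. $|\pi|$ denotes the number of elements permuted by $\pi$. $U_n$ denotes the $n$-th Chebyshev polynomial of the second kind, $U_n(\cos t)=\sin((n+1)t)/\sin t$. *)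

(* Defs.v *)
From HB Require Import structures.
From mathcomp Require Import all_boot all_order all_fingroup all_algebra.
From mathcomp Require Import all_classical all_reals all_analysis.
From mathcomp Require Import ring.

Set Implicit Arguments.
Unset Strict Implicit.
Unset Printing Implicit Defensive.

Import Order.TTheory GRing.Theory Num.Theory.

Local Open Scope ring_scope.

(** * Pattern occurrences *)

(* Indices and values are numbered from 0: [p] is the word (p 0)(p 1)...(p n.-1).
   An occurrence i_1 < ... < i_m is encoded as the map a |-> i_a. *)
Definition occurrences (m n : nat) (s : 'S_m) (p : 'S_n) :
    {set {ffun 'I_m -> 'I_n}} :=
  [set f : {ffun 'I_m -> 'I_n} |
     [forall a : 'I_m, forall b : 'I_m, (a < b)%N ==> (f a < f b)%N] &&
     [forall a : 'I_m, forall b : 'I_m,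
        (p (f a) < p (f b))%N == (s a < s b)%N]].

Definition avoids (m n : nat) (s : 'S_m) (p : 'S_n) : bool :=
  occurrences s p == finset.set0.

Definition pattern123 : 'S_3 := 1%g.

(* The pattern m (m-1) ... 1 (m+1). *)
Definition decr_max (m : nat) : 'S_m.+1 :=
  lift_perm ord_max ord_max (perm (@rev_ord_inj m)).

Lemma decr_maxE (m : nat) (i : 'I_m.+1) :
  decr_max m i = (if i == m :> nat then m else m - i.+1)%N :> nat.
Proof.
rewrite /decr_max; case: (unliftP ord_max i) => [j ->|->]; last first.
  by rewrite lift_perm_id eqxx.
by rewrite lift_perm_lift permE !lift_max /= (ltn_eqF (ltn_ord j)).
Qed.

(** * Formal power series *)

Record fps (K : Type) := Fps { fcoef : nat -> K }.

HB.instance Definition _ (K : Type) := gen_eqMixin (fps K).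
HB.instance Definition _ (K : Type) := gen_choiceMixin (fps K).

Lemma fpsP (K : Type) (f g : fps K) : (forall n, fcoef f n = fcoef g n) <-> f = g.
Proof.
split=> [|-> //]; case: f g => [f] [g] /= fg; congr Fps; exact/funext.
Qed.

Section FpsZmodule.
Variable K : zmodType.
Implicit Types f g h : fps K.

Definition fps_zero : fps K := Fps (fun=> 0).
Definition fps_opp f : fps K := Fps (fun n => - fcoef f n).
Definition fps_add f g : fps K := Fps (fun n => fcoef f n + fcoef g n).

Fact fps_addA : associative fps_add.
Proof. by move=> f g h; apply/fpsP => n /=; rewrite addrA. Qed.
Fact fps_addC : commutative fps_add.
Proof. by move=> f g; apply/fpsP => n /=; rewrite addrC. Qed.
Fact fps_add0 : left_id fps_zero fps_add.
Proof. by move=> f; apply/fpsP => n /=; rewrite add0r. Qed.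
Fact fps_addN : left_inverse fps_zero fps_opp fps_add.
Proof. by move=> f; apply/fpsP => n /=; rewrite addNr. Qed.

HB.instance Definition _ :=
  GRing.isZmodule.Build (fps K) fps_addA fps_addC fps_add0 fps_addN.

Lemma fcoef0 n : fcoef (0 : fps K) n = 0. Proof. by []. Qed.
Lemma fcoefD f g n : fcoef (f + g) n = fcoef f n + fcoef g n. Proof. by []. Qed.
Lemma fcoefN f n : fcoef (- f) n = - fcoef f n. Proof. by []. Qed.

End FpsZmodule.

Section FpsRing.
Variable K : idomainType.
Implicit Types f g h : fps K.

Definition fpsC (c : K) : fps K := Fps (fun n => if n == 0%N then c else 0).
Definition fpsX : fps K := Fps (fun n => (n == 1%N)%:R).
Definition fps_mul f g : fps K :=
  Fps (fun n => \sum_(i < n.+1) fcoef f i * fcoef g (n - i)%N).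

Let trunc (N : nat) f : {poly K} := \poly_(i < N) fcoef f i.

Let coef_trunc N f i : (i < N)%N -> (trunc N f)`_i = fcoef f i.
Proof. by move=> iN; rewrite coef_poly iN. Qed.

Let coef_trunc_mul N f g n : (n < N)%N ->
  fcoef (fps_mul f g) n = (trunc N f * trunc N g)`_n.
Proof.
move=> nN; rewrite coefM /=; apply: eq_bigr => i _.
have iN : (i < N)%N by apply: leq_trans nN.
have niN : (n - i < N)%N by apply: leq_ltn_trans nN; exact: leq_subr.
by rewrite !coef_trunc.
Qed.

Fact fps_mulC : commutative fps_mul.
Proof.
by move=> f g; apply/fpsP => n; rewrite !(coef_trunc_mul _ _ (ltnSn n)) mulrC.
Qed.

Fact fps_mulA : associative fps_mul.
Proof.
move=> f g h; apply/fpsP => n; rewrite !(coef_trunc_mul _ _ (ltnSn n)).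
transitivity ((trunc n.+1 f * (trunc n.+1 g * trunc n.+1 h))`_n).
  rewrite [LHS]coefM [RHS]coefM; apply: eq_bigr => i _; congr (_ * _).
  have lt : (n - i < n.+1)%N by rewrite ltnS leq_subr.
  by rewrite coef_trunc// (coef_trunc_mul _ _ lt).
rewrite mulrA [LHS]coefM [RHS]coefM; apply: eq_bigr => i _; congr (_ * _).
by rewrite coef_trunc// (coef_trunc_mul _ _ (ltn_ord i)).
Qed.

Fact fps_mul1 : left_id (fpsC 1) fps_mul.
Proof.
move=> f; apply/fpsP => n /=; rewrite big_ord_recl /= mul1r subn0.
by rewrite big1 ?addr0// => i _; rewrite mul0r.
Qed.

Fact fps_mulDl : left_distributive fps_mul +%R.
Proof.
move=> f g h; apply/fpsP => n /=; rewrite -big_split /=.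
by apply: eq_bigr => i _; rewrite mulrDl.
Qed.

Fact fps_oner_neq0 : fpsC 1 != 0.
Proof.
apply/eqP => /fpsP/(_ 0%N) /= /eqP; apply/negP; exact: oner_neq0.
Qed.

HB.instance Definition _ := GRing.Zmodule_isComNzRing.Build (fps K)
  fps_mulA fps_mulC fps_mul1 fps_mulDl fps_oner_neq0.

Lemma fcoefM f g n :
  fcoef (f * g) n = \sum_(i < n.+1) fcoef f i * fcoef g (n - i)%N.
Proof. by []. Qed.

Fact fpsC_is_zmod_morphism : zmod_morphism fpsC.
Proof. by move=> c d; apply/fpsP => -[|n] //=; rewrite subrr. Qed.

Fact fpsC_is_monoid_morphism : monoid_morphism fpsC.
Proof.
split=> // c d; apply/fpsP => n; rewrite fcoefM big_ord_recl /= subn0.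
rewrite big1 ?addr0 => [|i _]; last by rewrite mul0r.
by case: n => //= n; rewrite mulr0.
Qed.

HB.instance Definition _ :=
  GRing.isZmodMorphism.Build K (fps K) fpsC fpsC_is_zmod_morphism.
HB.instance Definition _ :=
  GRing.isMonoidMorphism.Build K (fps K) fpsC fpsC_is_monoid_morphism.

Definition fps_unit : pred (fps K) := fun f => `[< exists g, g * f = 1 >].
Definition fps_inv f : fps K :=
  if pselect (exists g, g * f = 1) is left ex then projT1 (cid ex) else f.

Fact fps_mulVf : {in fps_unit, left_inverse 1 fps_inv *%R}.
Proof.
move=> f /asboolP fU; rewrite /fps_inv.
by case: pselect => // ex; case: cid.
Qed.

Fact fps_unitPl f g : g * f = 1 -> fps_unit f.
Proof. by move=> gf; apply/asboolP; exists g. Qed.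

Fact fps_inv_out : {in [predC fps_unit], fps_inv =1 id}.
Proof.
move=> f /negP fU; rewrite /fps_inv; case: pselect => // ex.
by case: fU; apply/asboolP.
Qed.

HB.instance Definition _ := GRing.ComNzRing_hasMulInverse.Build (fps K)
  fps_mulVf fps_unitPl fps_inv_out.

Fact fps_lowest f : f != 0 ->
  exists n, fcoef f n != 0 /\ forall i, (i < n)%N -> fcoef f i = 0.
Proof.
move=> f0; have ex : exists n, fcoef f n != 0.
  apply: contrapT => nex; move/eqP: f0; apply; apply/fpsP => n.
  by apply/eqP; apply: contrapT => /negP fn; apply: nex; exists n.
case: (ex_minnP ex) => n fn min; exists n; split=> // i lt.
apply/eqP; apply: contraTT lt => fi; by rewrite -leqNgt min.
Qed.

Fact fps_idomain f g : f * g = 0 -> (f == 0) || (g == 0).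
Proof.
move=> fg0; case: (eqVneq f 0) => //= f0; apply: contraT => g0.
have [m [fm mf]] := fps_lowest f0; have [n [gn ng]] := fps_lowest g0.
have := congr1 (fun h => fcoef h (m + n)%N) fg0; rewrite fcoefM fcoef0.
have mmn : (m < (m + n).+1)%N by rewrite ltnS leq_addr.
rewrite (bigD1 (Ordinal mmn)) //= big1 => [|i im].
  by rewrite addr0 addKn => /eqP; rewrite mulf_eq0 (negPf fm) (negPf gn).
have : nat_of_ord i != m by [].
rewrite neq_ltn => /orP[lt|gt]; first by rewrite (mf _ lt) mul0r.
rewrite (ng (m + n - i)%N) ?mulr0//.
by rewrite ltn_subLR ?ltn_add2r// -ltnS ltn_ord.
Qed.

HB.instance Definition _ :=
  GRing.ComUnitRing_isIntegral.Build (fps K) fps_idomain.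

End FpsRing.

Arguments fpsX {K}.

(* [f(X)] maps to [f(X^2)]: when [X] stands for sqrt x, this views a power series
   in x as a power series in sqrt x. *)
Definition fps_compX2 (K : zmodType) (f : fps K) : fps K :=
  Fps (fun n => if odd n then 0 else fcoef f n./2).

(* The sum of x^|p| over all the permutations [p] (of any size) satisfying [A]. *)
Definition perm_gf (K : idomainType) (A : forall n, pred 'S_n) : fps K :=
  Fps (fun n => #|[set p : 'S_n | A n p]|%:R).

Definition laurent (K : fieldType) := {fraction fps K}.

Notation "f %:F" := (@FracField.tofrac _ f : laurent _) : ring_scope.

Definition laurentC (K : fieldType) (c : K) : laurent K := (fpsC c)%:F.

HB.instance Definition _ (K : fieldType) := GRing.RMorphism.copy (@laurentC K)
  (@FracField.tofrac (fps K) \o @fpsC K).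

(** * Chebyshev polynomials of the second kind *)

Definition is_chebyshevU (R : realType) (n : nat) (U : {poly R}) : Prop :=
  forall t : R, sin t != 0 -> U.[cos t] = sin (n.+1%:R * t) / sin t.

Lemma is_chebyshevU_ex (R : realType) (n : nat) :
  exists U : {poly R}, is_chebyshevU n U.
Proof.
suff [U [V [HU _]]] : exists U V : {poly R},
  is_chebyshevU n U /\ is_chebyshevU n.+1 V by exists U.
elim: n => [|n [U [V [HU HV]]]].
  exists 1, (2%:R *: 'X); split=> t t0; first by rewrite hornerC mul1r divff.
  by rewrite hornerZ hornerX mulr_natl mulr_natl sin_mulr2n mulrnAl mulfK.
exists V, (2%:R *: 'X * V - U); split=> // t t0.
rewrite !hornerE HV// HU//; apply: (mulIf t0).
rewrite mulrBl mulrA !divfK//.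
have -> : n.+3%:R * t = n.+2%:R * t + t by rewrite -[n.+3]addn1 natrD mulrDl mul1r.
have -> : n.+1%:R * t = n.+2%:R * t - t.
  by rewrite -[n.+2]addn1 natrD mulrDl mul1r addrK.
by rewrite sinB sinD; ring.
Qed.

Lemma is_chebyshevU_unique (R : realType) (n : nat) (U V : {poly R}) :
  is_chebyshevU n U -> is_chebyshevU n V -> U = V.
Proof.
move=> HU HV; apply/eqP; rewrite -subr_eq0; apply: contraT => UV0.
have bnd (i : nat) : 0 < (i.+1%:R^-1 : R) < pi.
  rewrite invr_gt0 ltr0n /= (@le_lt_trans _ _ 1)//.
    by rewrite invf_le1 ?ltr0n// ler1n.
  by rewrite (lt_le_trans _ (pi_ge2 R))// ltr1n.
pose s := [seq cos (i.+1%:R^-1 : R) | i <- iota 0 (size (U - V))].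
have : (size s < size (U - V)%R)%N; last by rewrite size_map size_iota ltnn.
apply: max_poly_roots => //.
  apply/allP => _ /mapP[i _ ->]; rewrite rootE !hornerE.
  have s0 : sin (i.+1%:R^-1 : R) != 0 by rewrite gt_eqF ?sin_gt0_pi.
  by rewrite HU// HV// subrr.
rewrite map_inj_uniq ?iota_uniq// => i j /cos_inj.
have mem (l : nat) : (l.+1%:R^-1 : R) \in `[0, pi].
  by rewrite in_itv /=; have /andP[/ltW -> /ltW ->] := bnd l.
by move=> /(_ (mem i) (mem j))/invr_inj/eqP; rewrite eqr_nat => /eqP[].
Qed.

(* Main.v *)
(* The smaller entries to the left of an entry of a 123-avoiding permutation are
   decreasing, so an entry with a smaller ones to its left is the last entry of
   'C(a, k - 1) occurrences. Building 123-avoiding permutations by appending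
   entries, all that matters is the number h + 1 of values that can be appended:
   the value 0 changes h into h + 1, a value 1 <= v <= h changes h into v and
   creates 'C(v, k - 1) occurrences. As r <= k - 1 excludes v >= k, all states
   h >= k - 1 are equivalent. If G h c is the generating function of the ways to
   go on from state h with c occurrences, then s ^ h * G h c, where s = sqrt x,
   satisfies the three-term recurrence of the polynomials U_n at 1 / (2 s) along
   0 <= h <= k - 1; solving it for each c gives G 0 (r - 1) = 1 / U_k ^ 2 and
   G 0 c = s * (U_(k-1) / U_k) * G 0 (c + 1) for c + 1 < r. *)
Require Import Defs.
From HB Require Import structures.
From mathcomp Require Import all_boot all_order all_fingroup all_algebra.
From mathcomp Require Import all_classical all_reals all_analysis.
From mathcomp Require Import zify ring.

Set Implicit Arguments.
Unset Strict Implicit.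
Unset Printing Implicit Defensive.

Import Order.TTheory GRing.Theory Num.Theory.
Local Open Scope ring_scope.

(** * Occurrences in a permutation with an appended entry *)

Lemma occurrencesP m n (s : 'S_m) (p : 'S_n) (f : {ffun 'I_m -> 'I_n}) :
  reflect ({homo f : a b / (a < b)%N} /\
           forall a b, (p (f a) < p (f b))%N = (s a < s b)%N)
          (f \in occurrences s p).
Proof.
rewrite inE; apply: (iffP andP) => -[/= f_incr f_pattern]; split.
- by move=> a b ab; have := forallP (forallP f_incr a) b; rewrite ab.
- by move=> a b; have /forallP/(_ b)/eqP := forallP f_pattern a.
- by apply/'forall_forallP => a b; apply/implyP; apply: f_incr.
- by apply/'forall_forallP => a b; apply/eqP; apply: f_pattern.
Qed.

Lemma increasing_inj m n (f : 'I_m -> 'I_n) :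
  {homo f : a b / (a < b)%N} -> injective f.
Proof.
move=> f_incr a b e; apply/val_inj.
by case: (ltngtP a b) => // /f_incr; rewrite e ltnn.
Qed.

Lemma occurrences_eq0 m n (s : 'S_m) (p : 'S_n) :
  (n < m)%N -> occurrences s p = finset.set0.
Proof.
move=> nm; apply/finset.setP => f; rewrite finset.in_set0; apply/negP.
move=> /occurrencesP[/increasing_inj/leq_card]; rewrite !card_ord.
by rewrite leqNgt nm.
Qed.

Lemma ltn_lift2 n (h : 'I_n.+1) (i j : 'I_n) :
  (lift h i < lift h j)%N = (i < j)%N.
Proof. by rewrite /= /bump; lia. Qed.

Lemma ltn_liftl n (h : 'I_n.+1) (i : 'I_n) : (lift h i < h)%N = (i < h)%N.
Proof. by rewrite /= /bump; lia. Qed.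

Lemma ltn_liftr n (h : 'I_n.+1) (i : 'I_n) : (h < lift h i)%N = (h <= i)%N.
Proof. by rewrite /= /bump; lia. Qed.

Lemma ltn_lift_max n (i : 'I_n) : (lift ord_max i < @ord_max n)%N.
Proof. by rewrite lift_max. Qed.

Lemma ord_max_ltnF n (i : 'I_n.+1) : (@ord_max n < i)%N = false.
Proof. by rewrite ltnNge -ltnS ltn_ord. Qed.

Definition perm_rcons n (p : 'S_n) (v : 'I_n.+1) : 'S_n.+1 :=
  lift_perm ord_max v p.

Lemma perm_rcons_max n (p : 'S_n) v : perm_rcons p v ord_max = v.
Proof. exact: lift_perm_id. Qed.

Lemma perm_rcons_lift n (p : 'S_n) v i :
  perm_rcons p v (lift ord_max i) = lift v (p i).
Proof. exact: lift_perm_lift. Qed.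

Lemma perm_rcons_bij n :
  bijective (fun pv : 'S_n * 'I_n.+1 => perm_rcons pv.1 pv.2).
Proof.
apply: inj_card_bij => [[p v] [p' v'] /= e|]; last first.
  by rewrite card_prod !card_Sn card_ord factS mulnC.
have ev : v = v' by rewrite -(perm_rcons_max p v) e perm_rcons_max.
congr pair => //; apply/permP => i; apply: (@lift_inj _ v).
by rewrite -perm_rcons_lift e perm_rcons_lift ev.
Qed.

Definition ffun_widen m n (f : {ffun 'I_m -> 'I_n}) : {ffun 'I_m -> 'I_n.+1} :=
  [ffun a => lift ord_max (f a)].

Definition ffun_rcons m n (f : {ffun 'I_m -> 'I_n}) :
    {ffun 'I_m.+1 -> 'I_n.+1} :=
  [ffun a => oapp (fun b => lift ord_max (f b)) ord_max (unlift ord_max a)].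

Lemma ffun_rcons_max m n (f : {ffun 'I_m -> 'I_n}) :
  ffun_rcons f ord_max = ord_max.
Proof. by rewrite ffunE unlift_none. Qed.

Lemma ffun_rcons_lift m n (f : {ffun 'I_m -> 'I_n}) a :
  ffun_rcons f (lift ord_max a) = lift ord_max (f a).
Proof. by rewrite ffunE liftK. Qed.

Lemma ffun_widen_inj m n : injective (@ffun_widen m n).
Proof.
move=> f g /ffunP e; apply/ffunP => a.
by have := e a; rewrite !ffunE => /lift_inj.
Qed.

Lemma ffun_rcons_inj m n : injective (@ffun_rcons m n).
Proof.
move=> f g /ffunP e; apply/ffunP => a.
by have := e (lift ord_max a); rewrite !ffun_rcons_lift => /lift_inj.
Qed.

Lemma ffun_widen_ex m n (f : {ffun 'I_m -> 'I_n.+1}) :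
  (forall a, f a != ord_max) -> exists g, f = ffun_widen g.
Proof.
move=> f_neq_max; have f_lt a : (f a < n)%N.
  by rewrite ltn_neqAle -ltnS ltn_ord andbT; apply: f_neq_max.
exists [ffun a => Ordinal (f_lt a)]; apply/ffunP => a.
by apply/val_inj; rewrite !ffunE; apply/esym/lift_max.
Qed.

Lemma occurrences_ffun_widen m n (t : 'S_m) (p : 'S_n) v
    (f : {ffun 'I_m -> 'I_n}) :
  (ffun_widen f \in occurrences t (perm_rcons p v)) = (f \in occurrences t p).
Proof.
have lt_widen a b : (ffun_widen f a < ffun_widen f b)%N = (f a < f b)%N.
  by rewrite !ffunE ltn_lift2.
have lt_rcons a b : (perm_rcons p v (ffun_widen f a)
    < perm_rcons p v (ffun_widen f b))%N = (p (f a) < p (f b))%N.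
  by rewrite !ffunE !perm_rcons_lift ltn_lift2.
apply/occurrencesP/occurrencesP => -[f_incr f_pattern]; split=> a b.
- by move=> ab; rewrite -(lt_widen a b) f_incr.
- by rewrite -lt_rcons f_pattern.
- by move=> ab; rewrite lt_widen; apply: f_incr.
- by rewrite lt_rcons f_pattern.
Qed.

Section OccurrencesRcons.
Variables m n : nat.
Implicit Types (s : 'S_m) (p : 'S_n) (v : 'I_n.+1) (w : 'I_m.+1).

Definition completed_occurrences s w p v : {set {ffun 'I_m -> 'I_n}} :=
  [set f in occurrences s p | [forall a, (p (f a) < v)%N == (s a < w)%N]].

Lemma occurrences_ffun_rcons s w p v (f : {ffun 'I_m -> 'I_n}) :
  (ffun_rcons f \in occurrences (perm_rcons s w) (perm_rcons p v))
  = (f \in completed_occurrences s w p v).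
Proof.
rewrite [RHS]inE; apply/occurrencesP/andP => [[f_incr f_pattern]|].
  split; last first.
    apply/forallP => a; have := f_pattern (lift ord_max a) ord_max.
    rewrite ffun_rcons_lift ffun_rcons_max !perm_rcons_lift !perm_rcons_max.
    by rewrite !ltn_liftl => ->.
  apply/occurrencesP; split=> a b.
    move=> ab; have := f_incr (lift ord_max a) (lift ord_max b).
    by rewrite !ffun_rcons_lift !ltn_lift2; apply.
  have := f_pattern (lift ord_max a) (lift ord_max b).
  by rewrite !ffun_rcons_lift !perm_rcons_lift !ltn_lift2.
move=> [/occurrencesP[f_incr f_pattern] /forallP f_below].
have lt_w a : (p (f a) < v)%N = (s a < w)%N by rewrite (eqP (f_below a)).
split=> a b.
  case: (unliftP ord_max a) => [a' ->|->]; last by rewrite ord_max_ltnF.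
  case: (unliftP ord_max b) => [b' ->|->].
    by rewrite !ffun_rcons_lift !ltn_lift2; apply: f_incr.
  by rewrite ffun_rcons_lift ffun_rcons_max !ltn_lift_max.
case: (unliftP ord_max a) => [a' ->|->];
  case: (unliftP ord_max b) => [b' ->|->];
  rewrite ?ffun_rcons_lift ?ffun_rcons_max ?perm_rcons_lift ?perm_rcons_max.
- by rewrite !ltn_lift2.
- by rewrite !ltn_liftl.
- by rewrite !ltn_liftr leqNgt lt_w -leqNgt.
- by rewrite !ltnn.
Qed.

Lemma occurrences_rcons s w p v :
  occurrences (perm_rcons s w) (perm_rcons p v)
  = (@ffun_widen m.+1 n @: occurrences (perm_rcons s w) p)
    :|: (@ffun_rcons m n @: completed_occurrences s w p v).
Proof.
apply/finset.setP => f; apply/idP/finset.setUP; last first.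
  case=> /imsetP[g gP ->]; first by rewrite occurrences_ffun_widen.
  by rewrite occurrences_ffun_rcons.
move=> fP; have [f_incr _] := occurrencesP _ _ _ fP.
have f_lift a : f (lift ord_max a) != ord_max.
  have := f_incr _ _ (ltn_lift_max a); apply: contraTneq => ->.
  by rewrite ord_max_ltnF.
case: (eqVneq (f ord_max) ord_max) => [f_max|f_max].
  have [g gE] : exists g, [ffun a : 'I_m => f (lift ord_max a)] = ffun_widen g.
    by apply: ffun_widen_ex => a; rewrite ffunE.
  have fE : f = ffun_rcons g.
    apply/ffunP => a; case: (unliftP ord_max a) => [b ->|->].
      by have /ffunP/(_ b) := gE; rewrite ffun_rcons_lift !ffunE.
    by rewrite ffun_rcons_max.
  by right; rewrite fE imset_f// -occurrences_ffun_rcons -fE.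
have [|g fE] := @ffun_widen_ex _ _ f.
  by move=> a; case: (unliftP ord_max a) => [b ->|->].
by left; rewrite fE imset_f// -(occurrences_ffun_widen _ _ v) -fE.
Qed.

Lemma card_occurrences_rcons s w p v :
  #|occurrences (perm_rcons s w) (perm_rcons p v)|
  = (#|occurrences (perm_rcons s w) p| + #|completed_occurrences s w p v|)%N.
Proof.
rewrite occurrences_rcons cardsU.
rewrite !card_imset; [|exact: ffun_rcons_inj|exact: ffun_widen_inj].
rewrite (_ : _ :&: _ = finset.set0) ?cards0 ?subn0//.
apply/finset.setP => f; rewrite !inE; apply/negP.
case/andP=> /imsetP[g _ ->] /imsetP[h _] /ffunP/(_ ord_max).
by rewrite ffun_rcons_max ffunE => /esym/eqP; apply/negP/neq_lift.
Qed.

Lemma avoids_rcons s w p v :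
  avoids (perm_rcons s w) (perm_rcons p v)
  = avoids (perm_rcons s w) p && (completed_occurrences s w p v == finset.set0).
Proof.
by rewrite /avoids -!cards_eq0 card_occurrences_rcons addn_eq0.
Qed.

End OccurrencesRcons.

(** * Appending an entry to a 123-avoiding permutation *)

(* The values that can be appended to [p] without creating an occurrence of 123
   are 0, ..., room p. *)
Definition room n (p : 'S_n) : nat :=
  \big[Order.min/n]_(ij : 'I_n * 'I_n
    | (ij.1 < ij.2)%N && (p ij.1 < p ij.2)%N) (p ij.2 : nat).

Lemma leq_roomP n (p : 'S_n) u :
  reflect ((u <= n)%N /\
           forall i j : 'I_n, (i < j)%N -> (p i < p j)%N -> (u <= p j)%N)
          (u <= room p)%N.
Proof.
apply: (iffP (@bigmin_geP _ nat _ _ _ _ _)) => -[un up]; split=> //.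
  by move=> i j ij pij; apply: (up (i, j)); rewrite ij.
by case=> i j /andP[]; apply: up.
Qed.

Lemma leq_room n (p : 'S_n) : (room p <= n)%N.
Proof. by have /leq_roomP[] := leqnn (room p). Qed.

Lemma leq_room_rconsP n (p : 'S_n) (v : 'I_n.+1) u :
  reflect [/\ (u <= n.+1)%N,
    forall i j : 'I_n, (i < j)%N -> (p i < p j)%N -> (u <= lift v (p j))%N
    & forall i : 'I_n, (p i < v)%N -> (u <= v)%N]
    (u <= room (perm_rcons p v))%N.
Proof.
apply: (iffP (leq_roomP _ _)) => [[un up]|[un up uv]]; split=> //.
- move=> i j ij pij; have := up (lift ord_max i) (lift ord_max j).
  by rewrite !perm_rcons_lift !ltn_lift2; apply.
- move=> i pv; have := up (lift ord_max i) ord_max (ltn_lift_max i).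
  by rewrite perm_rcons_lift perm_rcons_max ltn_liftl; apply.
move=> i j.
case: (unliftP ord_max i) => [i' ->|->]; last by rewrite ord_max_ltnF.
case: (unliftP ord_max j) => [j' ->|->].
  by rewrite !perm_rcons_lift !ltn_lift2; apply: up.
by move=> _; rewrite perm_rcons_lift perm_rcons_max ltn_liftl; apply: uv.
Qed.

Lemma room_rcons0 n (p : 'S_n) : room (perm_rcons p ord0) = (room p).+1.
Proof.
apply/eqP; rewrite eqn_leq; apply/andP; split.
  have /leq_room_rconsP[rn rp _] := leqnn (room (perm_rcons p ord0)).
  suff : ((room (perm_rcons p ord0)).-1 <= room p)%N by lia.
  apply/leq_roomP; split=> [|i j ij pij]; first by lia.
  by have := rp i j ij pij; rewrite lift0; lia.
have /leq_roomP[rn rp] := leqnn (room p).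
by apply/leq_room_rconsP; split=> // i j ij pij; rewrite lift0 ltnS (rp i).
Qed.

Lemma room_rcons_gt0 n (p : 'S_n) (v : 'I_n.+1) :
  (0 < v <= room p)%N -> room (perm_rcons p v) = v.
Proof.
move=> /andP[v_gt0 v_le]; apply/eqP; rewrite eqn_leq; apply/andP; split.
  have /leq_room_rconsP[_ _ room_le] := leqnn (room (perm_rcons p v)).
  have n_gt0 : (0 < n)%N by rewrite (leq_trans v_gt0)// -ltnS.
  by apply: (room_le (p^-1 (Ordinal n_gt0))%g); rewrite permKV.
have /leq_roomP[_ vp] := v_le.
apply/leq_room_rconsP; split=> [|i j ij pij|//]; first exact: ltnW.
by rewrite ltnW// ltn_liftr (vp i).
Qed.

Lemma completed_occurrences12_eq0 n (p : 'S_n) (v : 'I_n.+1) :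
  (completed_occurrences (1%g : 'S_2) ord_max p v == finset.set0)
  = (v <= room p)%N.
Proof.
apply/eqP/leq_roomP => [no_completion|[_ vp]].
  split=> [|i j ij pij]; first by rewrite -ltnS.
  pose f := [ffun a : 'I_2 => if a == ord0 then i else j].
  rewrite leqNgt; apply/negP => pv.
  have : f \in completed_occurrences (1%g : 'S_2) ord_max p v.
    rewrite inE; apply/andP; split; last first.
      apply/forallP => a; rewrite ffunE perm1 ltn_ord.
      by case: ifP => _; rewrite ?pv// (ltn_trans pij pv).
    apply/occurrencesP; split=> -[[|[|//]] ?] [[|[|//]] ?] //=;
      by rewrite !ffunE ?perm1 ?ltnn//= ltnNge ltnW.
  by rewrite no_completion inE.
apply/finset.setP => f; rewrite finset.in_set0 inE; apply/negP.
case/andP=> /occurrencesP[f_incr f_pattern] /forallP f_below.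
have := vp (f ord0) (f ord_max) (f_incr ord0 ord_max isT).
rewrite f_pattern !perm1 => /(_ isT); rewrite leqNgt; apply/negP; rewrite negbK.
by rewrite (eqP (f_below ord_max)) perm1.
Qed.

Lemma avoids123_rcons n (p : 'S_n) (v : 'I_n.+1) :
  avoids pattern123 (perm_rcons p v)
  = avoids pattern123 p && (v <= room p)%N.
Proof.
have -> : pattern123 = perm_rcons (1%g : 'S_2) ord_max.
  exact/esym/lift_perm1.
by rewrite avoids_rcons completed_occurrences12_eq0.
Qed.

Definition increasing_ffuns m n (B : {set 'I_n}) : {set {ffun 'I_m -> 'I_n}} :=
  [set f : {ffun 'I_m -> 'I_n} |
     [forall a : 'I_m, forall b : 'I_m, (a < b)%N ==> (f a < f b)%N] &&
     [forall a, f a \in B]].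

Lemma increasing_ffunsP m n (B : {set 'I_n}) (f : {ffun 'I_m -> 'I_n}) :
  reflect ({homo f : a b / (a < b)%N} /\ forall a, f a \in B)
          (f \in increasing_ffuns m B).
Proof.
rewrite inE; apply: (iffP andP) => -[/= f_incr fB]; split.
- by move=> a b ab; have := forallP (forallP f_incr a) b; rewrite ab.
- exact/forallP.
- by apply/'forall_forallP => a b; apply/implyP; apply: f_incr.
- exact/forallP.
Qed.

Lemma codom_increasing_sorted m n (f : {ffun 'I_m -> 'I_n}) :
  {homo f : a b / (a < b)%N} -> sorted <%O (codom f).
Proof.
move=> f_incr; rewrite sorted_map.
apply: (@sub_sorted _ (fun a b : 'I_m => (a < b)%N)); first exact: f_incr.
by have := iota_ltn_sorted 0 m; rewrite -val_enum_ord sorted_map.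
Qed.

Lemma card_increasing_ffuns m n (B : {set 'I_n}) :
  #|increasing_ffuns m B| = 'C(#|B|, m).
Proof.
pose image (f : {ffun 'I_m -> 'I_n}) := [set i in codom f].
rewrite -cards_draws -(@card_in_imset _ _ image); last first.
  move=> f g /increasing_ffunsP[f_incr _] /increasing_ffunsP[g_incr _].
  move=> /finset.setP fg; apply/ffunP => a.
  suff /eq_in_map -> : codom f = codom g by rewrite ?mem_enum.
  apply: lt_sorted_eq.
  - exact: codom_increasing_sorted.
  - exact: codom_increasing_sorted.
  - by move=> i; have := fg i; rewrite !inE.
apply: eq_card => A; rewrite inE; apply/imsetP/andP.
  case=> f /increasing_ffunsP[f_incr fB] ->; split.
    by apply/fintype.subsetP => i; rewrite inE => /codomP[a ->].
  by rewrite cardsE card_codom ?card_ord//; apply: increasing_inj.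
move=> [/fintype.subsetP AB /eqP Am].
pose f := [ffun a => @Order.enum_val _ _ A (cast_ord (esym Am) a)].
have fA a : f a \in A by rewrite ffunE Order.enum_valP.
have f_incr : {homo f : a b / (a < b)%N}.
  move=> a b ab; suff : (f a < f b)%O by [].
  by rewrite !ffunE (leW_mono (@Order.le_enum_val _ _ (@le_total _ 'I_n) A)).
exists f; first by apply/increasing_ffunsP; split=> // a; apply: AB.
apply/esym/eqP; rewrite eqEcard cardsE card_codom; last exact: increasing_inj.
rewrite card_ord Am leqnn andbT; apply/fintype.subsetP => i.
by rewrite inE => /codomP[a ->].
Qed.

Lemma card_perm_ltn n (p : 'S_n) v :
  (v <= n)%N -> #|[set i | (p i < v)%N]| = v.
Proof.
move=> vn; transitivity #|[set i : 'I_n | (i < v)%N]|.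
  rewrite -[RHS](card_preimset _ (@perm_inj _ p)).
  by apply: eq_card => i; rewrite !inE.
by rewrite -sum1dep_card (big_ord_narrow vn) sum_nat_const card_ord muln1.
Qed.

Definition perm_rev m : 'S_m := perm (@rev_ord_inj m).

Lemma completed_occurrences_rev m n (p : 'S_n) (v : 'I_n.+1) :
  (v <= room p)%N ->
  completed_occurrences (perm_rev m) ord_max p v
  = increasing_ffuns m [set i | (p i < v)%N].
Proof.
move=> /leq_roomP[_ vp]; apply/finset.setP => f; rewrite [LHS]inE.
apply/andP/increasing_ffunsP => [[/occurrencesP[f_incr _] /forallP f_below]|].
  by split=> // a; rewrite inE (eqP (f_below a)) ltn_ord.
move=> [f_incr f_below]; have pf_lt a : (p (f a) < v)%N.
  by have := f_below a; rewrite inE.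
have pf_decr (a b : 'I_m) : (a < b)%N -> (p (f b) < p (f a))%N.
  move=> /f_incr ab; case: ltngtP => // [pab|/val_inj/perm_inj e].
    by have := vp _ _ ab pab; rewrite leqNgt pf_lt.
  by rewrite e ltnn in ab.
split; last by apply/forallP => a; rewrite pf_lt ltn_ord.
apply/occurrencesP; split=> // a b; rewrite !permE /=.
case: (ltngtP a b) => [ab|ba|/val_inj ->]; last by rewrite !ltnn.
  by rewrite ltnNge ltnW ?pf_decr//; have := ltn_ord b; lia.
by rewrite pf_decr//; have := ltn_ord a; lia.
Qed.

Lemma card_decr_max_rcons m n (p : 'S_n) (v : 'I_n.+1) :
  (v <= room p)%N ->
  #|occurrences (decr_max m) (perm_rcons p v)|
  = (#|occurrences (decr_max m) p| + 'C(v, m))%N.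
Proof.
move=> vp; rewrite (card_occurrences_rcons (perm_rev m)).
rewrite completed_occurrences_rev// card_increasing_ffuns.
by rewrite card_perm_ltn// -ltnS.
Qed.

(** * Counting 123-avoiding permutations *)

(* If [F h c] is the weight of a 123-avoiding permutation with room [h] and [c]
   occurrences of [decr_max m], this is the total weight of the 123-avoiding
   permutations obtained by appending an entry to it: the entry 0 changes the
   room into [h.+1], and [v.+1 <= h] changes it into [v.+1]. *)
Definition append_sum (V : nmodType) m (F : nat -> nat -> V) (h c : nat) : V :=
  F h.+1 c + \sum_(v < h) F v.+1 (c + 'C(v.+1, m))%N.

Lemma sum_avoids123_rcons (V : nmodType) m (F : nat -> nat -> V) n :
  (0 < m)%N ->
  \sum_(q : 'S_n.+1 | avoids pattern123 q)
      F (room q) #|occurrences (decr_max m) q|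
  = \sum_(p : 'S_n | avoids pattern123 p)
      append_sum m F (room p) #|occurrences (decr_max m) p|.
Proof.
move=> m_gt0; rewrite (reindex _ (onW_bij _ (@perm_rcons_bij n))) /=.
transitivity (\sum_(p : 'S_n | avoids pattern123 p)
    \sum_(v : 'I_n.+1 | (v <= room p)%N)
      F (room (perm_rcons p v)) #|occurrences (decr_max m) (perm_rcons p v)|).
  by rewrite pair_big_dep; apply: eq_bigl => pv; rewrite avoids123_rcons.
apply: eq_bigr => p _.
rewrite big_mkcond big_ord_recl /= room_rcons0 card_decr_max_rcons//.
rewrite bin_small// addn0; congr (_ + _).
rewrite (big_ord_widen n (fun v => F v.+1 (_ + 'C(v.+1, m))%N) (leq_room p)).
rewrite [RHS]big_mkcond; apply: eq_bigr => v _.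
by case: ifP => // vp; rewrite room_rcons_gt0 ?card_decr_max_rcons.
Qed.

Lemma sum_avoids123 (V : nmodType) m (F : nat -> nat -> V) n :
  (0 < m)%N ->
  \sum_(p : 'S_n | avoids pattern123 p) F (room p) #|occurrences (decr_max m) p|
  = iter n (append_sum m) F 0%N 0%N.
Proof.
move=> m_gt0; elim: n F => [|n IH] F; last first.
  by rewrite sum_avoids123_rcons// IH -iterSr.
rewrite (bigD1 1%g) /=; last by rewrite /avoids occurrences_eq0.
rewrite big1 ?addr0 => [|p /andP[_ /eqP[]]]; last by apply/permP => -[].
rewrite occurrences_eq0// cards0; congr (F _ _).
by apply/eqP; rewrite -leqn0 leq_room.
Qed.

(* [continuations K m r n h c] is the number of ways to append [n] entries to a
   123-avoiding permutation with room [h] and [c] occurrences of [decr_max m] so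
   that the result avoids 123 and has [r] occurrences. *)
Definition continuations (K : nzSemiRingType) m r n : nat -> nat -> K :=
  iter n (append_sum m) (fun _ c => (c == r)%:R).

Lemma card_avoids123_occurrences (K : nzSemiRingType) m r n : (0 < m)%N ->
  #|[set p : 'S_n | avoids pattern123 p
                    && (#|occurrences (decr_max m) p| == r)]|%:R
  = continuations K m r n 0 0.
Proof.
move=> m_gt0; rewrite /continuations -sum_avoids123// -sum1dep_card.
by rewrite natr_sum big_mkcondr; apply: eq_bigr => p _; case: eqP.
Qed.

Section Recursion.
Variables (K : nzSemiRingType) (m r : nat).
Local Notation w := (continuations K m r).

Lemma continuations_eq0 n h c : (r < c)%N -> w n h c = 0.
Proof.
elim: n h c => [|n IH] h c rc; first by rewrite /= gtn_eqF.
rewrite /= /append_sum IH// add0r big1// => v _.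
by apply: IH; apply: ltn_addr.
Qed.

Lemma continuations_saturated n h c :
  (r <= m)%N -> (m <= h)%N -> w n h c = w n m c.
Proof.
move=> rm; elim: n h c => [//|n IH] h c mh; rewrite /= /append_sum.
rewrite (IH h.+1) ?(leq_trans mh)// (IH m.+1)//; congr (_ + _).
rewrite (big_ord_widen _ (fun v => w n v.+1 (c + 'C(v.+1, m))%N) mh).
rewrite [RHS]big_mkcond; apply: eq_bigr => v _; case: ltnP => // mv.
apply: continuations_eq0; rewrite (leq_trans _ (leq_addl _ _))//.
by rewrite (leq_trans _ (leq_bin2l _ (mv : m.+1 <= v.+1)%N))// binSn.
Qed.

Lemma continuations_below n h c : (h.+1 < m)%N ->
  w n.+1 h.+1 c = w n.+1 h c + w n h.+2 c.
Proof.
move=> hm; rewrite /= /append_sum big_ord_recr /= bin_small// addn0.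
by rewrite addrC [X in X + _ = _]addrC.
Qed.

End Recursion.

Lemma continuations_top (K : nzSemiRingType) m r n c : (r <= m.+1)%N ->
  continuations K m.+1 r n.+1 m.+1 c
  = continuations K m.+1 r n.+1 m c + continuations K m.+1 r n m.+1 c.+1.
Proof.
move=> rm; rewrite /= /append_sum big_ord_recr /= binn addn1 addrA.
by rewrite -/(continuations K m.+1 r n) continuations_saturated.
Qed.

(** * Generating functions *)

Lemma fcoefXM (K : idomainType) (f : fps K) n :
  fcoef (fpsX * f) n = if n is n'.+1 then fcoef f n' else 0.
Proof.
rewrite fcoefM; case: n => [|n]; first by rewrite big_ord1 mul0r.
rewrite big_ord_recl mul0r add0r big_ord_recl mul1r subSS subn0.
by rewrite big1 ?addr0// => i _; rewrite mul0r.
Qed.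

Lemma sum_odd0 (V : nmodType) (F : nat -> V) n :
  (forall i, odd i -> F i = 0) ->
  \sum_(i < n.*2.+1) F i = \sum_(i < n.+1) F i.*2.
Proof.
move=> F_odd; elim: n => [|n IH]; first by rewrite !big_ord1.
rewrite doubleS big_ord_recr big_ord_recr IH [RHS]big_ord_recr /=.
by rewrite F_odd ?addr0//= odd_double.
Qed.

Lemma fcoef_compX2_odd (K : zmodType) (f : fps K) n :
  odd n -> fcoef (fps_compX2 f) n = 0.
Proof. by move=> /= ->. Qed.

Lemma fcoef_compX2_double (K : zmodType) (f : fps K) n :
  fcoef (fps_compX2 f) n.*2 = fcoef f n.
Proof. by rewrite /= odd_double doubleK. Qed.

Lemma fps_compX2_is_zmod_morphism (K : zmodType) :
  zmod_morphism (@fps_compX2 K).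
Proof.
by move=> f g; apply/fpsP => n /=; case: ifP => // _; rewrite subr0.
Qed.

HB.instance Definition _ (K : zmodType) :=
  GRing.isZmodMorphism.Build (fps K) (fps K) (@fps_compX2 K)
    (@fps_compX2_is_zmod_morphism K).

Lemma fps_compX2_is_monoid_morphism (K : idomainType) :
  monoid_morphism (@fps_compX2 K).
Proof.
split=> [|f g]; apply/fpsP => n; first by case: n => [|[|n]] //=; case: ifP.
case: (boolP (odd n)) => [n_odd|/even_halfK <-].
  rewrite fcoef_compX2_odd// fcoefM big1// => i _.
  case: (boolP (odd i)) => i_odd; first by rewrite fcoef_compX2_odd// mul0r.
  rewrite [X in _ * X]fcoef_compX2_odd ?mulr0// oddB; last by rewrite -ltnS.
  by rewrite n_odd (negPf i_odd).
pose F i := fcoef (fps_compX2 f) i * fcoef (fps_compX2 g) (n./2.*2 - i)%N.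
rewrite fcoef_compX2_double !fcoefM (@sum_odd0 _ F) => [|i i_odd].
  by apply: eq_bigr => i _; rewrite /F -doubleB !fcoef_compX2_double.
by rewrite /F fcoef_compX2_odd ?mul0r.
Qed.

HB.instance Definition _ (K : idomainType) :=
  GRing.isMonoidMorphism.Build (fps K) (fps K) (@fps_compX2 K)
    (@fps_compX2_is_monoid_morphism K).

Lemma fps_compX2X (K : idomainType) : fps_compX2 fpsX = fpsX ^+ 2 :> fps K.
Proof.
apply/fpsP => n; rewrite fcoefXM.
by case: n => [|[|[|[|n]]]] //=; case: ifP.
Qed.

Definition continuations_gf (K : idomainType) m r h c : fps K :=
  Fps (fun n => continuations K m r n h c).

Lemma perm_gf_continuations (K : idomainType) m r : (0 < m)%N ->
  perm_gf K (fun n (p : 'S_n) =>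
    avoids pattern123 p && (#|occurrences (decr_max m) p| == r))
  = continuations_gf K m r 0 0.
Proof. by move=> m_gt0; apply/fpsP => n; apply: card_avoids123_occurrences. Qed.

Section ContinuationsGF.
Variables (K : idomainType) (m r : nat).

Lemma continuations_gf_eq0 h c : (r < c)%N -> continuations_gf K m r h c = 0.
Proof. by move=> rc; apply/fpsP => n; rewrite /= continuations_eq0. Qed.

Lemma continuations_gf_0 c :
  continuations_gf K m r 0 c
  = (c == r)%:R + fpsX * continuations_gf K m r 1 c.
Proof.
apply/fpsP => -[|n]; rewrite fcoefD fcoefXM /=.
  by rewrite addr0; case: (c == r).
rewrite /continuations /= {1}/append_sum big_ord0 addr0.
by case: (c == r); rewrite add0r.
Qed.

Lemma continuations_gf_below h c : (h.+1 < m)%N ->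
  continuations_gf K m r h.+1 c
  = continuations_gf K m r h c + fpsX * continuations_gf K m r h.+2 c.
Proof.
move=> hm; apply/fpsP => -[|n]; rewrite fcoefD fcoefXM ?addr0//.
exact: continuations_below.
Qed.

End ContinuationsGF.

Lemma continuations_gf_top (K : idomainType) m r c : (r <= m.+1)%N ->
  continuations_gf K m.+1 r m.+1 c
  = continuations_gf K m.+1 r m c + fpsX * continuations_gf K m.+1 r m.+1 c.+1.
Proof.
move=> rm; apply/fpsP => -[|n]; rewrite fcoefD fcoefXM ?addr0//.
exact: continuations_top.
Qed.

Lemma fpsX_neq0 (K : fieldType) : fpsX%:F != 0 :> laurent K.
Proof.
rewrite tofrac_eq0; apply/eqP => /fpsP/(_ 1%N) /eqP.
by rewrite fcoef0 oner_eq0.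
Qed.

(** * Solving the recurrence *)

Definition chebyshev_seq (L : fieldType) (s : L) (u : nat -> L) : Prop :=
  [/\ u 0%N = 1, u 1%N = s^-1 & forall n, u n.+2 = u n.+1 / s - u n].

Lemma chebyshev_seq_forward (L : fieldType) (s : L) (u y : nat -> L) m :
  chebyshev_seq s u -> y 1%N = y 0%N / s ->
  (forall n, (n < m)%N -> y n.+2 = y n.+1 / s - y n) ->
  forall n, (n <= m.+1)%N -> y n = u n * y 0%N.
Proof.
move=> [u0 u1 uS] y1 yS n.
suff : ((n <= m.+1)%N -> y n = u n * y 0%N)
    /\ ((n <= m)%N -> y n.+1 = u n.+1 * y 0%N) by case.
elim: n => [|n [IHn IHn1]]; first by rewrite u0 u1 mul1r mulrC.
split=> [/IHn1//|nm]; rewrite yS// uS mulrBl mulrAC.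
by rewrite -IHn1 ?(ltnW nm)// -IHn// leqW// ltnW.
Qed.

Lemma chebyshev_seq_backward (L : fieldType) (s : L) (u y : nat -> L) m :
  chebyshev_seq s u -> y m = y m.+1 / s ->
  (forall n, (n < m)%N -> y n.+2 = y n.+1 / s - y n) ->
  forall n, (n <= m.+1)%N -> y (m.+1 - n)%N = u n * y m.+1.
Proof.
move=> u_cheb y_m yS.
rewrite -{2}[m.+1]subn0; pose z n := y (m.+1 - n)%N.
apply: (@chebyshev_seq_forward _ s _ z) => //; first by rewrite /z subSS !subn0.
move=> n nm; rewrite /z subSS.
have -> : (m.+1 - n.+1 = (m - n.+1).+1)%N by lia.
have -> : (m.+1 - n = (m - n.+1).+2)%N by lia.
by rewrite yS; [ring|lia].
Qed.

(* The sequences [y c] are coupled at the top: [y c.+1 m.+1] occurs where the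
   recurrence of [y c] would need [y c m.+2]. *)
Definition transfer_system (L : fieldType) (s : L) m r (y : nat -> nat -> L) :
    Prop :=
  [/\ forall c h, (h < m)%N -> y c h.+2 = y c h.+1 / s - y c h,
      forall c, y c 0%N = (c == r)%:R + s * y c 1%N,
      forall c, s * y c.+1 m.+1 = y c m.+1 / s - y c m
    & y r.+1 m.+1 = 0].

Section TransferSystem.
Variables (L : fieldType) (s : L) (u : nat -> L) (m : nat).
Hypotheses (s_neq0 : s != 0) (u_cheb : chebyshev_seq s u).

Lemma transfer_system_shift r y :
  transfer_system s m r.+1 y -> transfer_system s m r (fun c => y c.+1).
Proof.
by case=> y_below y_bottom y_top y_r; split=> // c h; apply: y_below.
Qed.

Lemma transfer_system_homogeneous r y c :
  transfer_system s m r y -> (c < r)%N ->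
  y c m.+1 = u m.+1 * y c 0%N /\ u m.+2 * y c 0%N = s * y c.+1 m.+1.
Proof.
move=> [y_below y_bottom y_top _] cr; have [_ _ uS] := u_cheb.
have y1 : y c 1%N = y c 0%N / s.
  by rewrite (y_bottom c) (ltn_eqF cr) add0r mulrAC divff ?mul1r.
have yE := chebyshev_seq_forward u_cheb y1 (y_below c).
split; first exact: yE.
by rewrite y_top (yE m.+1)// (yE m)// uS mulrBl mulrAC.
Qed.

Lemma transfer_system_inhomogeneous r y :
  transfer_system s m r y -> u m.+2 * y r m.+1 = s^-1.
Proof.
move=> [y_below y_bottom y_top y_r]; have [_ _ uS] := u_cheb.
have y_m : y r m = y r m.+1 / s.
  by apply/esym/eqP; rewrite -subr_eq0 -y_top y_r mulr0.
have yE := chebyshev_seq_backward u_cheb y_m (y_below r).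
have y0 := yE m.+1 (leqnn _); have y1 := yE m (leqnSn _).
rewrite subnn in y0; rewrite subSnn in y1.
apply: (mulfI s_neq0); rewrite uS mulrBl mulrAC -y0 -y1 mulrBr.
by rewrite mulrCA mulfV// mulr1 y_bottom eqxx addrK.
Qed.

Lemma transfer_system_solution r y :
  transfer_system s m r.+1 y ->
  y 0%N 0%N = s ^+ r * (u m.+1 ^+ r / u m.+2 ^+ r.+2).
Proof.
move=> y_sys; have u_neq0 : u m.+2 != 0.
  have := transfer_system_inhomogeneous y_sys; apply: contra_eq_neq => ->.
  by rewrite mul0r eq_sym invr_eq0.
elim: r y y_sys => [|r IH] y y_sys.
  have [_ y_first] := transfer_system_homogeneous y_sys (ltn0Sn 0).
  do 2 apply: (mulfI u_neq0).
  rewrite y_first mulrCA (transfer_system_inhomogeneous y_sys) !exprS.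
  by field; rewrite s_neq0 u_neq0.
have [_ y_first] := transfer_system_homogeneous y_sys (ltn0Sn r.+1).
have [y_last _] := transfer_system_homogeneous y_sys (isT : 1 < r.+2)%N.
apply: (mulfI u_neq0); rewrite y_first y_last.
rewrite (IH _ (transfer_system_shift y_sys)) !exprS.
by field; rewrite u_neq0 expf_neq0.
Qed.

End TransferSystem.

Lemma transfer_system_scale (L : fieldType) (s : L) m r (G : nat -> nat -> L) :
  s != 0 ->
  (forall h c, (h < m)%N -> G h.+1 c = G h c + s ^+ 2 * G h.+2 c) ->
  (forall c, G 0%N c = (c == r)%:R + s ^+ 2 * G 1%N c) ->
  (forall c, G m.+1 c = G m c + s ^+ 2 * G m.+1 c.+1) ->
  G m.+1 r.+1 = 0 ->
  transfer_system s m r (fun c h => s ^+ h * G h c).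
Proof.
move=> s_neq0 G_below G_bottom G_top G_r; split=> [c h hm|c|c|].
- by rewrite (G_below h c hm) !exprS; field.
- by rewrite mul1r expr1 mulrA G_bottom.
- by rewrite (G_top c) !exprS; field.
- by rewrite G_r mulr0.
Qed.

Lemma continuations_gf_transfer (K : idomainType) (L : fieldType)
    (phi : {rmorphism fps K -> L}) (s : L) m r :
  s != 0 -> phi fpsX = s ^+ 2 -> (r <= m.+1)%N ->
  transfer_system s m r
    (fun c h => s ^+ h * phi (continuations_gf K m.+1 r h c)).
Proof.
move=> s_neq0 phiX rm.
apply: (@transfer_system_scale _ _ _ _
  (fun h c => phi (continuations_gf K m.+1 r h c))) => //.
- by move=> h c hm; rewrite continuations_gf_below// rmorphD rmorphM phiX.
- by move=> c; rewrite continuations_gf_0 rmorphD rmorphM phiX rmorph_nat.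
- by move=> c; rewrite {1}continuations_gf_top// rmorphD rmorphM phiX.
- by rewrite continuations_gf_eq0// rmorph0.
Qed.

(** * Chebyshev polynomials *)

Section Chebyshev.
Variables (R : realType) (U : nat -> {poly R}).
Hypothesis U_cheb : forall n : nat, is_chebyshevU n (U n).

Lemma chebyshevU0 : U 0%N = 1.
Proof.
apply: (is_chebyshevU_unique (U_cheb 0)) => t t0.
by rewrite hornerC mul1r divff.
Qed.

Lemma chebyshevU1 : U 1%N = 2%:R *: 'X.
Proof.
apply: (is_chebyshevU_unique (U_cheb 1)) => t t0.
by rewrite hornerZ hornerX !mulr_natl sin_mulr2n mulrnAl mulfK.
Qed.

Lemma chebyshevUSS n : U n.+2 = 2%:R *: 'X * U n.+1 - U n.
Proof.
apply: (is_chebyshevU_unique (U_cheb n.+2)) => t t0.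
rewrite !hornerE !U_cheb//; apply: (mulIf t0).
rewrite mulrBl mulrA !divfK//.
have -> : n.+3%:R * t = n.+2%:R * t + t by rewrite -natr1 mulrDl mul1r.
have -> : n.+1%:R * t = n.+2%:R * t - t.
  by rewrite -[n.+2%:R]natr1 mulrDl mul1r addrK.
by rewrite sinB sinD; ring.
Qed.

Lemma chebyshevU_seq (L : fieldType) (phi : {rmorphism R -> L}) (s : L) :
  s != 0 -> chebyshev_seq s (fun n => (map_poly phi (U n)).[1 / (2 * s)]).
Proof.
move=> s_neq0; have two_neq0 : 2 != 0 :> L.
  by rewrite -(rmorph_nat phi) fmorph_eq0 pnatr_eq0.
have two_div : phi 2%:R / (2 * s) = s^-1.
  by rewrite rmorph_nat; field; rewrite s_neq0 two_neq0.
split=> [||n].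
- by rewrite chebyshevU0 rmorph1 hornerC.
- by rewrite chebyshevU1 map_polyZ map_polyX hornerZ hornerX mul1r two_div.
rewrite chebyshevUSS rmorphB rmorphM /= map_polyZ map_polyX hornerD hornerN.
by rewrite hornerM hornerZ hornerX mul1r two_div mulrC.
Qed.

End Chebyshev.

Theorem theorem10 (R : realType) (U : nat -> {poly R})
    (U_cheb : forall n : nat, is_chebyshevU n (U n))
    (k r : nat) (k_ge2 : (2 <= k)%N) (r_bounds : (1 <= r <= k - 1)%N) :
  let s : laurent R := fpsX%:F in
  let Us (n : nat) : laurent R := (map_poly (@laurentC R) (U n)).[1 / (2 * s)] in
  (fps_compX2 (perm_gf R (fun n (p : 'S_n) =>
     avoids pattern123 p && (#|occurrences (decr_max (k - 1)) p| == r))))%:F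
  = s ^+ (r - 1) * (Us (k - 1)%N ^+ (r - 1) / Us k ^+ (r + 1)).
Proof.
move=> s Us; have s_neq0 : s != 0 := fpsX_neq0 R.
pose phi : {rmorphism fps R -> laurent R} :=
  (@FracField.tofrac (fps R) \o @fps_compX2 R).
have phiX : phi fpsX = s ^+ 2 by rewrite /= fps_compX2X rmorphXn.
case: k k_ge2 r_bounds => [//|[//|m]] _; rewrite subn1 [m.+2.-1]/=.
case: r => [//|r] /andP[_ rm]; rewrite subn1 addn1 [r.+1.-1]/=.
rewrite perm_gf_continuations// -[LHS]mul1r.
exact: (transfer_system_solution s_neq0 (chebyshevU_seq U_cheb _ s_neq0)
  (continuations_gf_transfer s_neq0 phiX rm)).
Qed.
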